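(* For all distributions of $Z$, the expected height of the tree rooted at vertex $0$ satisfies $$\lim_{n\to\infty}\mathbb{E} H_n^{(0)}=\infty.$$
   Context: $\mathbb{N}=\{1,2,\ldots\}$. Let $Z,Z_1,Z_2,\ldots$ be independent, identically distributed random variables taking values in $\mathbb{N}$. The coloring $(C_n)_{n\in\mathbb{Z}}$ is defined by $C_i=i$ for all integers $i\le 0$ and $C_n=C_{n-Z_n}$ for $n\in\mathbb{N}$. In the associated forest on $\mathbb{Z}$, each $i\le 0$ is the root of a tree, and each $n\in\mathbb{N}$ is attached by an edge to its parent $n-Z_n$; the tree rooted at $0$ at time $n$ consists of $0$ and of all $t\in\{1,\ldots,n\}$ with $C_t=0$. $H_n^{(0)}$ denotes the height of this tree: the maximum path length (number of edges) from a vertex of the tree to the root $0$ (equal to $0$ if the tree consists of the root only). *)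

(* Defs.v *)
(* MathComp / MathComp-Analysis *)
From HB Require Import structures.
From mathcomp Require Import all_boot all_order all_algebra.
From mathcomp Require Import all_classical all_reals all_analysis.
From mathcomp Require Import zify.

Set Implicit Arguments.
Unset Strict Implicit.
Unset Printing Implicit Defensive.

Import Order.TTheory GRing.Theory Num.Theory.
Local Open Scope classical_set_scope.
Local Open Scope ring_scope.

Section Forest.
(* [z n] is the value of Z_n; only the values at n >= 1 are used. *)
Variable z : nat -> nat.
Implicit Types i j : int.

(* Roots are made fixed points of [parent]; they have no parent edge. *)
Definition parent i : int := if i <= 0 then i else i - (z `|i|)%:Z.

(* When all z n >= 1, `|i| steps are enough to reach a root, so that [color]
   is the function satisfying [color_root] and [color_rec] below. *)
Definition color i : int := iter `|i|%N parent i.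

Definition forest_edge i j : bool :=
  ((0 < i) && (j == parent i)) || ((0 < j) && (i == parent j)).

Definition tree0 (n : nat) : {set 'I_n.+1} :=
  [set t : 'I_n.+1 | color (t : nat)%:Z == 0].

(* [t :: p] is a path (without repeated vertices) of the tree rooted at 0 at
   time n, from t to the root; it has [size p] edges. *)
Definition path_to_root (n : nat) (t : 'I_n.+1) (p : seq 'I_n.+1) : bool :=
  [&& path (fun s u : 'I_n.+1 => forest_edge (s : nat)%:Z (u : nat)%:Z) t p,
      last t p == ord0, uniq (t :: p) & all (mem (tree0 n)) (t :: p)].

(* A path without repeated vertices in {0, ..., n} has at most n edges, so the
   bound on k is harmless. *)
Definition height0 (n : nat) : nat :=
  \max_(t in tree0 n)
    \max_(k < n.+1 | [exists p : k.-tuple 'I_n.+1, path_to_root t p]) k.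

Lemma iter_parent_root k i : i <= 0 -> iter k parent i = i.
Proof. by move=> i0; elim: k => //= k ->; rewrite /parent i0. Qed.

Lemma color_root i : i <= 0 -> color i = i.
Proof. exact: iter_parent_root. Qed.

Section Positive.
Hypothesis z_gt0 : forall n, (0 < n)%N -> (0 < z n)%N.

Lemma iter_parent_le0 k i : (`|i| <= k)%N -> iter k parent i <= 0.
Proof.
elim: k i => [|k IH] i ik; first by rewrite /=; lia.
have [i0|i0] := leP i 0; first by rewrite iter_parent_root.
rewrite iterSr.
have [p0|p0] := leP (parent i) 0; first by rewrite iter_parent_root.
apply: IH; move: p0; rewrite /parent leNgt i0 /=.
by have := z_gt0 (n := `|i|%N); lia.
Qed.

Lemma iter_parent_color k i : (`|i| <= k)%N -> iter k parent i = color i.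
Proof.
move=> ik; rewrite -(subnK ik) iterD iter_parent_root//.
exact: iter_parent_le0.
Qed.

Lemma color_rec (n : nat) :
  (0 < n)%N -> color n%:Z = color (n%:Z - (z n)%:Z).
Proof.
move=> n0; rewrite -(@iter_parent_color n.+1 n) ?absz_nat// iterSr.
have -> : parent n = n%:Z - (z n)%:Z by rewrite /parent leNgt ltz_nat n0.
have [p0|p0] := leP (n%:Z - (z n)%:Z) 0.
  by rewrite iter_parent_root// color_root.
by rewrite iter_parent_color//; lia.
Qed.
End Positive.
End Forest.

Section Iid.
Context d (Omega : measurableType d) (R : realType) (P : probability Omega R).

(* Mutual independence of (X i), i in I: the product rule for every finite
   subfamily [J], given as a duplicate-free sequence of indices. *)
Definition independent_RVs (I : set nat) (X : nat -> {RV P >-> nat}) : Prop :=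
  forall (J : seq nat) (A : nat -> set nat),
    uniq J -> (forall i, i \in J -> I i) ->
    (forall i, i \in J -> measurable (A i)) ->
    P (\big[setI/setT]_(i <- J) (X i @^-1` A i)) =
    (\prod_(i <- J) P (X i @^-1` A i))%E.

Definition has_law (X : {RV P >-> nat}) (mu : probability nat R) : Prop :=
  forall A : set nat, measurable A -> distribution P X A = mu A.
End Iid.

(* Main.v *)
Require Import Defs.
From HB Require Import structures.
From mathcomp Require Import all_boot all_order all_algebra.
From mathcomp Require Import all_classical all_reals all_analysis.
From mathcomp Require Import measurable_realfun.
From mathcomp Require Import zify lra.

Set Implicit Arguments.
Unset Strict Implicit.
Unset Printing Implicit Defensive.

Import Order.TTheory GRing.Theory Num.Theory.
Local Open Scope classical_set_scope.
Local Open Scope ring_scope.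

(** Let [N_k] be the number of vertices of the [k]-th generation, i.e. of those
    that reach the root 0 after exactly [k] jumps.  The tree has height at
    least [k] as soon as [N_k > 0], so the expected height dominates the sum
    over [k] of the probabilities that [N_k > 0].  The forest behaves like a
    critical branching process with offspring variance at most 1: for every law
    of the jumps the probability that [N_k > 0] is at least [1 / (k + 1)], and
    the harmonic series diverges.

    First moment.  Walking from [t] towards its ancestors uses each [Z_i] at
    most once, so the ancestors of [t] form a random walk with i.i.d. steps, and
    [t] is in generation [k] with probability [P(S_k = t)], where [S_k] is a sum
    of [k] independent copies of [Z] ([hit], [prob_descent]).  Summing over all
    [t] gives [E N_k = 1]; the vertices up to [n] already contribute almost 1
    for [n] large ([sum_hit_near1]).

    Second moment.  If [s] and [t] are both in generation [k], let [m] be the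
    vertex where their ancestral lines merge, and [j] its generation.  Before
    merging the two lines use disjoint sets of jumps, so they are independent,
    as is the common line from [m] to 0.  The sum over [s], [t] and [m] of the
    resulting products is at most 1 for each of the [k + 1] values of [j], hence
    [E N_k^2 <= k + 1] ([prob_descent_pair], [sum_pair_bound]).

    The inequality [2 a N - a^2 N^2 <= 1_(N > 0)] with [a = 1 / (k + 1)] turns
    these two estimates into the lower bound on the probability that [N_k > 0]
    ([second_moment_bound], [prob_generation_ge]). *)

(** * Generations of the tree and its height *)

Section Ancestry.
Variable z : nat -> nat.
Implicit Types (k t u n : nat).

(** [descends k t]: the ancestral line of [t] reaches 0 after [k] jumps and not
    earlier.  Jumps of length 0, which [z] may have here, are excluded so that
    the line strictly decreases. *)
Fixpoint descends k t : bool :=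
  if k is k'.+1 then (0 < z t <= t)%N && descends k' (t - z t) else t == 0%N.

Lemma descends_inj k l t : descends k t -> descends l t -> k = l.
Proof.
elim: k l t => [|k IH] [|l] t //=; [by lia|by lia|].
by move=> /andP[_ dk] /andP[_ dl]; rewrite (IH _ _ dk dl).
Qed.

Lemma descends_le k t : descends k t -> (k <= t)%N.
Proof.
elim: k t => [|k IH] t //= /andP[zt /IH]; lia.
Qed.

Lemma descends_iter_parent k t : descends k t -> iter k (parent z) t%:Z = 0.
Proof.
elim: k t => [|k IH] t; first by move=> /= /eqP ->.
rewrite iterSr => /= /andP[zt /IH <-]; congr (iter _ _ _).
rewrite /parent absz_nat; case: ifP => [|_]; lia.
Qed.

Lemma descends_color k t : descends k t -> color z t%:Z = 0.
Proof.
move=> dk; rewrite /color absz_nat -{1}(subnK (descends_le dk)) iterD.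
by rewrite descends_iter_parent// iter_parent_root.
Qed.

(** The path is the ancestral line itself; the bound on its vertices makes the
    induction yield the absence of repetitions. *)
Lemma descends_path n k (t : 'I_n.+1) : descends k t ->
  exists p : k.-tuple 'I_n.+1,
    path_to_root z t p /\ forall u : 'I_n.+1, u \in (p : seq _) -> (u < t)%N.
Proof.
elim: k t => [|k IH] t dt.
  exists [tuple]; split=> //; rewrite /path_to_root/= andbT inE.
  by rewrite (descends_color dt) eqxx andbT; apply/eqP/val_inj/eqP; exact: dt.
have /= /andP[zt du] := dt.
have un : (t - z t < n.+1)%N by have := ltn_ord t; lia.
have [p [/and4P[pp lp up ap] ltp]] := IH (Ordinal un) du.
have lttp (u : 'I_n.+1) : u \in Ordinal un :: p -> (u < t)%N.
  rewrite inE => /predU1P[-> /=|/ltp /=]; by lia.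
exists [tuple of Ordinal un :: p]; split=> //; apply/and4P; split=> //.
- rewrite [path _ _ _]/= pp andbT; apply/orP; left; rewrite /parent absz_nat /=.
  by case: ifP => [|_]; lia.
- rewrite [tval _]/= cons_uniq up andbT; apply/negP => /lttp; by rewrite ltnn.
- rewrite [tval _]/= [all _ _]/= -/(all _ (Ordinal un :: p)) ap andbT inE.
  by rewrite (descends_color dt).
Qed.

Lemma descends_height n k t :
  (t <= n)%N -> descends k t -> (k <= height0 z n)%N.
Proof.
move=> tn dk; have tn' : (t < n.+1)%N by [].
have t0 : Ordinal tn' \in tree0 z n by rewrite inE (descends_color dk).
have kn : (k < n.+1)%N by have := descends_le dk; lia.
apply: (bigop.bigmax_sup _ t0); apply: (bigop.bigmax_sup (Ordinal kn)) => //.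
have [p [pp _]] := @descends_path n k (Ordinal tn') dk.
by apply/existsP; exists p.
Qed.

(** The root, generation 0, is left out: a height [h] accounts for at most the
    [h] generations 1, ..., [h]. *)
Lemma sum_generations_le_height n K :
  (\sum_(k < K) [exists t : 'I_n.+1, descends k.+1 t] <= height0 z n)%N.
Proof.
apply: (@leq_trans (\sum_(k < K) (k < height0 z n))).
  apply: leq_sum => k _; case: existsP => // -[t dt].
  by rewrite (descends_height _ dt)// -ltnS.
elim: K => [|K IH]; first by rewrite big_ord0.
rewrite big_ord_recr /=.
have : (\sum_(i < K) (i < height0 z n) <= K)%N.
  by rewrite -[leqRHS]card_ord -sum1_card leq_sum// => i _; case: (_ < _)%N.
case: (ltnP K (height0 z n)) => Kh /= SK; last by rewrite addn0.
by rewrite addn1 (leq_ltn_trans SK).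
Qed.

End Ancestry.

(** * Hitting probabilities of the ancestral random walk *)

Section Hit.
Variables (R : realType) (p : nat -> R).
Hypothesis p_ge0 : forall j, 0 <= p j.
Hypothesis sum_p_le1 : forall n, \sum_(1 <= j < n) p j <= 1.

(** The probability that a walk which starts at [t] and jumps down by
    independent steps of law [p] sits at [m] after [k] jumps, all of its
    positions being nonnegative; equivalently the [k]-fold convolution, at
    [t - m], of [p] restricted to positive lengths.  The sum is over the first
    position [u] below [t]. *)
Fixpoint hit (k m t : nat) : R :=
  if k is k'.+1 then \sum_(u < t) p (t - u) * hit k' m u else (t == m)%:R.

Lemma hit_ge0 k m t : 0 <= hit k m t.
Proof.
by elim: k t => //= k IH t; apply: sumr_ge0 => u _; rewrite mulr_ge0.
Qed.

(** Exchanging the sums over [t] and over its parent [u] leaves the mass of the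
    jumps of length less than [n - u]. *)
Lemma sum_hitS k m n : \sum_(t < n) hit k.+1 m t =
  \sum_(u < n) (\sum_(1 <= j < n - u) p j) * hit k m u.
Proof.
transitivity (\sum_(t < n) \sum_(u < n | (u < t)%N) p (t - u) * hit k m u).
  apply: eq_bigr => t _ /=.
  by rewrite (big_ord_widen n (fun u => p (t - u) * hit k m u))// ltnW.
rewrite (exchange_big_dep xpredT)//=; apply: eq_bigr => u _.
rewrite -mulr_suml; congr (_ * _).
rewrite -(big_mkord (fun t => u < t)%N (fun t => p (t - u))).
have un := ltn_ord u.
rewrite (big_cat_nat (n := u.+1))//=.
rewrite big_nat_cond big_pred0 ?add0r; last by move=> i; lia.
rewrite -[u.+1]add1n big_addn big_nat_cond [RHS]big_nat_cond.
by apply: eq_big => [j|j _]; [lia|rewrite addnK].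
Qed.

Lemma sum_hit_le1 k m n : \sum_(t < n) hit k m t <= 1.
Proof.
elim: k => [|k IH].
  have [mn|nm] := ltnP m n; last first.
    by rewrite big1// => t _ /=; case: eqP => //; have := ltn_ord t; lia.
  rewrite (bigD1 (Ordinal mn))//= eqxx big1 ?addr0// => t.
  by rewrite -val_eqE /= => /negPf ->.
rewrite sum_hitS; apply: le_trans IH; apply: ler_sum => u _.
by rewrite ler_piMl ?hit_ge0.
Qed.

Hypothesis sum_p_near1 : forall e, 0 < e ->
  exists n0, forall n, (n0 <= n)%N -> 1 - e <= \sum_(1 <= j < n) p j.

(** If [k] jumps total less than [a] and one more is less than [n - a], their
    sum is less than [n]; hence the mass of the [k.+1]-fold convolution below
    [n] is at least the product of two masses close to 1. *)
Lemma sum_hit_near1 k e : 0 < e ->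
  exists n0, forall n, (n0 <= n)%N -> 1 - e <= \sum_(t < n) hit k 0 t.
Proof.
elim: k e => [|k IH] e e0.
  exists 1%N => -[//|n] _; rewrite big_ord_recl.
  rewrite -[leLHS]addr0 lerD//; last by apply: sumr_ge0 => i _; exact: hit_ge0.
  by rewrite /= gerBl ltW.
have e2 : 0 < e / 2 by lra.
have [a ha] := IH _ e2; have [b hb] := sum_p_near1 e2.
exists (a + b).+1 => n abn; rewrite sum_hitS.
have an : (a <= n)%N by lia.
have bn : (b <= n - a)%N by lia.
have := ha _ (leqnn a); have := hb _ bn.
have := sum_hit_le1 k 0 a; have := sum_p_le1 (n - a).
set F := \sum_(t < a) _; set G := \sum_(1 <= j < n - a) _ => G1 F1 Gge Fge.
(* (1 - F) (1 - G) >= 0 gives G F >= F + G - 1. *)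
apply: (@le_trans _ _ (G * F)); first by nra.
rewrite mulr_sumr (big_ord_widen n (fun u => G * hit k 0 u))// big_mkcond /=.
apply: ler_sum => u _; case: ifP => [ua|_].
  rewrite ler_wpM2r ?hit_ge0//.
  rewrite /G (big_cat_nat (n := n - a) (p := n - u)); [|lia|lia].
  by rewrite lerDl sumr_ge0.
by rewrite mulr_ge0 ?hit_ge0 ?sumr_ge0.
Qed.

(** Sum over the merging vertex [m] of two ancestral lines and its generation
    [j]: one walk from [m] to 0, and two independent walks from [s] and [t] to
    [m].  It only bounds the probability that the lines of [s] and [t] have
    lengths [k] and [l], since the two walks to [m] may meet before [m].
    The lengths [k] and [l] may differ because the two lines are followed one
    jump at a time. *)
Definition pair_bound N k l s t : R :=
  \sum_(j < (minn k l).+1) \sum_(m < N)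
    hit j 0 m * (hit (k - j) m s * hit (l - j) m t).

Lemma pair_boundC N k l s t : pair_bound N k l s t = pair_bound N l k t s.
Proof.
rewrite /pair_bound minnC; apply: eq_bigr => j _; apply: eq_bigr => m _.
by congr (_ * _); rewrite mulrC.
Qed.

Lemma pair_bound_ge0 N k l s t : 0 <= pair_bound N k l s t.
Proof.
by apply: sumr_ge0 => j _; apply: sumr_ge0 => m _; rewrite !mulr_ge0 ?hit_ge0.
Qed.

(** Two lines issued from the same vertex merge there: this is the term [m = s],
    [j = k]. *)
Lemma pair_bound_diag N k s : (s < N)%N -> hit k 0 s <= pair_bound N k k s s.
Proof.
move=> sN; rewrite /pair_bound minnn (bigD1 ord_max)//= (bigD1 (Ordinal sN))//=.
rewrite subnn /= eqxx !mulr1 -addrA lerDl addr_ge0// ?sumr_ge0// => *.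
  by rewrite !mulr_ge0 ?hit_ge0.
by apply: sumr_ge0 => *; rewrite !mulr_ge0 ?hit_ge0.
Qed.

(** Splitting the walk issued from [t] according to its first jump accounts for
    the terms [j <= l] on the right; in a term [j = l.+1] that walk makes no
    jump. *)
Lemma pair_bound_step N k l s t :
  \sum_(u < t) p (t - u) * pair_bound N k l s u <= pair_bound N k l.+1 s t.
Proof.
under eq_bigr do rewrite mulr_sumr; rewrite exchange_big /=.
pose G j := \sum_(m < N) hit j 0 m * (hit (k - j) m s * hit (l.+1 - j) m t).
have G0 j : 0 <= G j by apply: sumr_ge0 => m _; rewrite !mulr_ge0 ?hit_ge0.
rewrite [leRHS](_ : _ = \sum_(j < (minn k l.+1).+1) G j)//.
rewrite -(big_mkord xpredT G) (big_cat_nat (n := (minn k l).+1))//=; last lia.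
rewrite big_mkord; apply: (@le_trans _ _ (\sum_(j < (minn k l).+1) G j));
  last by rewrite lerDl sumr_ge0.
apply: ler_sum => j _; rewrite /G le_eqVlt; apply/orP; left; apply/eqP.
under eq_bigr do rewrite mulr_sumr; rewrite exchange_big /=.
apply: eq_bigr => m _; rewrite subSn; last by have := ltn_ord j; lia.
rewrite [hit _.+1 m t]/= !mulr_sumr; apply: eq_bigr => u _.
by rewrite mulrCA; congr (_ * _); rewrite mulrCA.
Qed.

(** For fixed [j] and [m] the sums over [s] and [t] factor into two masses at
    most 1, and the remaining sum over [m] is again at most 1: each of the
    [k.+1] generations [j] contributes at most 1. *)
Lemma sum_pair_bound N k :
  \sum_(s < N) \sum_(t < N) pair_bound N k k s t <= k.+1%:R.
Proof.
pose F k m := \sum_(t < N) hit k m t.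
have F0 i m : 0 <= F i m by rewrite sumr_ge0// => *; exact: hit_ge0.
have F1 i m : F i m <= 1 by exact: sum_hit_le1.
have -> : \sum_(s < N) \sum_(t < N) pair_bound N k k s t =
    \sum_(j < k.+1) \sum_(m < N) hit j 0 m * (F (k - j)%N m * F (k - j)%N m).
  rewrite /pair_bound minnn.
  under eq_bigr do rewrite exchange_big /=; rewrite exchange_big /=.
  apply: eq_bigr => j _.
  under eq_bigr do rewrite exchange_big /=; rewrite exchange_big /=.
  apply: eq_bigr => m _; rewrite big_distrlr mulr_sumr /=.
  by apply: eq_bigr => s _; rewrite mulr_sumr.
have -> : k.+1%:R = \sum_(j < k.+1) 1 :> R by rewrite sumr_const card_ord.
apply: ler_sum => j _; apply: le_trans (F1 j 0%N); apply: ler_sum => m _.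
by rewrite ler_piMr ?hit_ge0// mulr_ile1.
Qed.
End Hit.

(** * A second moment inequality *)

Section Expectation.
Context d (T : measurableType d) (R : realType) (P : probability T R).
Local Notation Pr A := (fine (P A)).

(** The integral of a nonnegative function is a supremum over the simple
    functions below it, so it is monotone even when [g] is not measurable; the
    function [g] of interest is the height of the tree. *)
Lemma ge0_le_integral_nonmeasurable (f g : T -> \bar R) :
  (forall x, 0 <= f x)%E -> (forall x, f x <= g x)%E ->
  (\int[P]_x f x <= \int[P]_x g x)%E.
Proof.
move=> f0 fg; rewrite !ge0_integralTE//.
  apply: le_ereal_sup => _ [h hf <-]; exists h => // x.
  exact: le_trans (hf x) (fg x).
by move=> x; apply: le_trans (fg x).
Qed.

Lemma integral_sum_indic (I : Type) (r : seq I) (A : I -> set T) :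
  (forall i, measurable (A i)) ->
  (\int[P]_x (\sum_(i <- r) \1_(A i) x)%:E = (\sum_(i <- r) Pr (A i))%:E)%E.
Proof.
move=> mA; under eq_integral do rewrite -sumEFin.
rewrite ge0_integral_sum//.
- rewrite -sumEFin; apply: eq_bigr => i _.
  by rewrite integral_indic// setIT fineK// fin_num_measure.
- by move=> i; apply/measurable_EFinP; exact: measurable_indic.
Qed.

(** With [N] the number of the events [A t] that occur, this is the expectation
    of [2 a N <= 1_(N > 0) + a^2 N^2], which is [0 <= (a N - 1)^2] when
    [N > 0].  It bounds the probability of a union from below, with a parameter
    instead of the quotient of the Cauchy-Schwarz inequality. *)
Lemma second_moment_bound (n : nat) (A : nat -> set T) (a : R) :
  (forall i, measurable (A i)) -> 0 <= a ->
  2 * a * (\sum_(t < n) Pr (A t)) <=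
  Pr (\big[setU/set0]_(t < n) A t) +
    a ^+ 2 * (\sum_(s < n) \sum_(t < n) Pr (A s `&` A t)).
Proof.
move=> mA a0.
have mS (I : finType) (B : I -> set T) : (forall i, measurable (B i)) ->
    measurable_fun [set: T] (fun x => (\sum_(i : I) \1_(B i) x : R)%:E).
  move=> mB; apply/measurable_EFinP; apply: measurable_sum => i.
  exact: measurable_indic.
have mAA (st : 'I_n * 'I_n) : measurable (A st.1 `&` A st.2).
  exact: measurableI.
have mU : measurable (\big[setU/set0]_(t < n) A t).
  exact: bigsetU_measurable.
rewrite -lee_fin EFinD (EFinM (2 * a)) (EFinM (a ^+ 2)) pair_big /=.
rewrite -(@integral_sum_indic _ _ (fun t : 'I_n => A t))//.
rewrite -(@integral_sum_indic _ _
  (fun st : 'I_n * 'I_n => A st.1 `&` A st.2))//.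
rewrite fineK ?fin_num_measure// -[P (bigop _ _ _)](congr1 P (setIT _)).
rewrite -integral_indic//.
have a2 : (0 <= (2 * a)%:E)%E by rewrite lee_fin mulr_ge0.
have aa : (0 <= (a ^+ 2)%:E)%E by rewrite lee_fin sqr_ge0.
rewrite -(ge0_integralZl P measurableT (mS 'I_n (fun t => A t) _) _ a2)//;
  last by move=> x _; rewrite lee_fin sumr_ge0.
rewrite -(ge0_integralZl P measurableT (mS _ _ mAA) _ aa)//; last first.
  by move=> x _; rewrite lee_fin sumr_ge0.
rewrite -ge0_integralD//; last 3 first.
- by apply/measurable_EFinP; exact: measurable_indic.
- by move=> x _; rewrite mule_ge0 ?lee_fin ?sqr_ge0// sumr_ge0.
- by apply: measurable_funeM; exact: mS.
apply: ge0_le_integral_nonmeasurable => x.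
  by rewrite mule_ge0 ?lee_fin ?mulr_ge0// sumr_ge0.
rewrite -!EFinM -EFinD lee_fin.
set N := \sum_(t < n) \1_(A t) x.
have -> : \sum_(st : 'I_n * 'I_n) \1_(A st.1 `&` A st.2) x = N * N.
  rewrite big_distrlr pair_big /=; apply: eq_bigr => -[s t] _.
  by rewrite indicI.
rewrite indicE; case: (boolP (x \in _)) => [_|xU] /=.
  by have := sqr_ge0 (a * N - 1); nra.
have -> : N = 0; last by rewrite !mulr0 addr0.
rewrite /N big1// => t _; rewrite indicE memNset// => At.
by move/negP: xU; apply; rewrite inE -bigcup_mkord; exists t => //=.
Qed.
End Expectation.

(** * Generations of the random tree *)

Section Process.
Context (R : realType) (mu : probability nat R)
    (d : measure_display) (Omega : measurableType d)
    (P : probability Omega R) (Z : nat -> {RV P >-> nat}).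
Hypotheses (Z_pos : forall n, (1 <= n)%N -> forall w, (1 <= Z n w)%N)
    (Z_law : forall n, (1 <= n)%N -> has_law (Z n) mu)
    (Z_indep : independent_RVs [set n | (1 <= n)%N] Z).

Local Notation Pr A := (fine (P A)).
Definition pmf (v : nat) : R := fine (mu [set v]).

Definition descent k t : set Omega := [set w | descends (fun i => Z i w) k t].
Definition jump (t v : nat) : set Omega := Z t @^-1` [set v].

Lemma descent0 t : descent 0 t = if t == 0%N then setT else set0.
Proof.
by apply/seteqP; split=> w; rewrite /descent /=; case: ifP.
Qed.

Lemma descentS k t :
  descent k.+1 t = \big[setU/set0]_(u < t) (jump t (t - u) `&` descent k u).
Proof.
rewrite -(bigcup_mkord t (fun u => jump t (t - u) `&` descent k u)).
apply/seteqP; split=> w /=.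
  move=> /andP[zt dk]; exists (t - Z t w)%N; first by rewrite /=; lia.
  by split=> //; rewrite /jump /=; lia.
move=> [u /= ut [Ztw]]; rewrite /jump /= in Ztw *.
rewrite /descent /= Ztw subKn ?(ltnW ut)// => ->.
by rewrite andbT; lia.
Qed.

Lemma measurable_jump t v : measurable (jump t v).
Proof. exact: measurable_funPTI. Qed.

Lemma measurable_descent k t : measurable (descent k t).
Proof.
elim: k t => [|k IH] t; last first.
  rewrite descentS; apply: bigsetU_measurable => u _.
  by apply: measurableI; [exact: measurable_jump|exact: IH].
by rewrite descent0; case: ifP.
Qed.

(** The first jump of the ancestral line of [t] goes to some [u < t], and
    different [u] give disjoint events.  The extra event [E] makes room for what
    is required besides: jumps revealed earlier, or another ancestral line. *)
Lemma prob_descentS k t E : measurable E ->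
  Pr (descent k.+1 t `&` E) =
  \sum_(u < t) Pr (descent k u `&` (jump t (t - u) `&` E)).
Proof.
move=> mE; pose F u := descent k u `&` (jump t (t - u) `&` E).
have mF u : measurable (F u).
  apply: measurableI; first exact: measurable_descent.
  by apply: measurableI => //; exact: measurable_jump.
have -> : descent k.+1 t `&` E = \big[setU/set0]_(u < t) F u.
  rewrite descentS big_distrl /=; apply: eq_bigr => u _.
  by rewrite /F setIA (setIC (jump _ _)).
rewrite measure_semi_additive_ord_I//.
- by rewrite sum_fine// => u _; rewrite fin_num_measure//; exact: mF.
- apply/trivIsetP => i j /= it jt ij.
  rewrite -subset0 => w [[_ [Zi _]] [_ [Zj _]]].
  by move: Zi Zj; rewrite /jump /=; move/eqP: ij; lia.
- by apply: bigsetU_measurable.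
Qed.

(** Events that prescribe finitely many jumps, all made at vertices beyond [m].
    They record the part of the ancestral lines already explored, when what
    remains lies at or below [m]; independence factors such events out. *)
Definition future_event m (C : set Omega) :=
  exists (J : seq nat) (a : nat -> nat),
  [/\ uniq J, forall i, i \in J -> (m < i)%N &
      C = \big[setI/setT]_(i <- J) jump i (a i)].

Lemma future_setT m : future_event m setT.
Proof. by exists [::], id; split=> //; rewrite big_nil. Qed.

Lemma measurable_future m C : future_event m C -> measurable C.
Proof.
move=> [J [a [_ _ ->]]]; apply: bigsetI_measurable => i _.
exact: measurable_jump.
Qed.

Lemma future_jump m t v C :
  (m < t)%N -> future_event t C -> future_event m (jump t v `&` C).
Proof.
move=> mt [J [a [uJ Jt ->]]].
exists (t :: J), (fun i => if i == t then v else a i).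
have tJ : t \notin J by apply/negP => /Jt; rewrite ltnn.
split; first by rewrite /= tJ.
  by move=> i; rewrite inE => /predU1P[->//|/Jt]; exact: ltn_trans.
rewrite big_cons eqxx; congr (_ `&` _); apply: eq_big_seq => i iJ.
by case: eqP => // it; move: iJ; rewrite it (negPf tJ).
Qed.

Lemma prob_future_jump t v C : (0 < t)%N -> future_event t C ->
  Pr (jump t v `&` C) = pmf v * Pr C.
Proof.
move=> t0 [J [a [uJ Jt ->]]].
have tJ : t \notin J by apply/negP => /Jt; rewrite ltnn.
have J1 i : i \in J -> (1 <= i)%N by move=> /Jt; lia.
pose A i := if i == t then [set v] else [set a i].
have -> : jump t v `&` \big[setI/setT]_(i <- J) jump i (a i) =
    \big[setI/setT]_(i <- t :: J) (Z i @^-1` A i).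
  rewrite big_cons /A eqxx; congr (_ `&` _); apply: eq_big_seq => i iJ.
  by case: eqP => // it; move: iJ; rewrite it (negPf tJ).
(* The product rule for [t :: J], and below, in reverse, for [J]. *)
rewrite Z_indep/=; last 3 first.
- by rewrite tJ.
- by move=> i; rewrite inE => /predU1P[->//|/J1].
- by [].
rewrite /A big_cons eqxx fineM; last 2 first.
- by rewrite fin_num_measure//; exact: measurable_jump.
- rewrite prode_fin_num// => i _; rewrite fin_num_measure//.
  exact: measurable_funPTI.
congr (fine _ * fine _); first exact: Z_law.
rewrite [RHS](Z_indep (A := fun i => [set a i]))//.
apply: eq_big_seq => i iJ.
by case: eqP => // it; move: iJ; rewrite it (negPf tJ).
Qed.

(** Each jump explored from [t] joins the future event [C], which stays
    independent of what lies below. *)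
Lemma prob_descent k t C :
  future_event t C -> Pr (descent k t `&` C) = hit pmf k 0 t * Pr C.
Proof.
elim: k t C => [|k IH] t C fC.
  rewrite descent0 /=; case: ifP => _; first by rewrite setTI mul1r.
  by rewrite set0I measure0 mul0r.
rewrite prob_descentS; last exact: measurable_future fC.
rewrite /= mulr_suml; apply: eq_bigr => u _; have ut := ltn_ord u.
rewrite IH; last exact: future_jump.
by rewrite prob_future_jump 1?mulrCA ?mulrA//; lia.
Qed.

Lemma pmf_ge0 v : 0 <= pmf v.
Proof. exact: fine_ge0. Qed.

(** Always explore the higher of the two current vertices: its jump is
    independent of all that lies below it, including the other line.  Once the
    two vertices coincide the lines have merged, and the remaining lengths must
    agree. *)
Lemma prob_descent_pair N k l s t C :
  (s < N)%N -> (t < N)%N -> future_event (maxn s t) C ->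
  Pr (descent k s `&` (descent l t `&` C)) <= pair_bound pmf N k l s t * Pr C.
Proof.
have PrC (D : set Omega) : 0 <= Pr D by exact: fine_ge0.
move: {2}(s + t).+1 (ltnSn (s + t)%N) => M; elim: M k l s t C => // M IH.
move=> k l s t C; rewrite ltnS => stM sN tN fC.
wlog st : k l s t C stM sN tN fC / (s <= t)%N.
  move=> W; have [|ts] := leqP s t; first exact: W.
  rewrite pair_boundC setICA.
  by apply: W => //; [rewrite addnC|rewrite maxnC|exact: ltnW].
have mC := measurable_future fC.
move: st fC; rewrite leq_eqVlt => /predU1P[<-{t tN stM}|st].
  rewrite maxnn => fC; have [<-{l}|kl] := eqVneq k l.
    rewrite setIA setIid prob_descent// ler_wpM2r// pair_bound_diag//.
    exact: pmf_ge0.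
  rewrite [X in P X](_ : _ = set0) ?measure0 /=.
    by rewrite mulr_ge0// pair_bound_ge0//; exact: pmf_ge0.
  rewrite -subset0 => w [dk [dl _]]; move/eqP: kl; apply.
  exact: descends_inj dk dl.
rewrite (maxn_idPr (ltnW st)) => fC; case: l => [|l].
  rewrite [X in P X](_ : _ = set0) ?measure0 /=.
    by rewrite mulr_ge0// pair_bound_ge0//; exact: pmf_ge0.
  rewrite -subset0 => w [_ []]; rewrite /descent /= => /eqP t0.
  by move: st; rewrite t0.
rewrite setICA prob_descentS; last first.
  by apply: measurableI => //; exact: measurable_descent.
have step_bound : \sum_(u < t) pmf (t - u) * pair_bound pmf N k l s u * Pr C <=
    pair_bound pmf N k l.+1 s t * Pr C.
  by rewrite -mulr_suml ler_wpM2r// pair_bound_step//; exact: pmf_ge0.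
apply: le_trans step_bound; apply: ler_sum => u _; have ut := ltn_ord u.
rewrite (setICA (jump _ _)) (setICA (descent l u)).
have mt : (maxn s u < t)%N by rewrite gtn_max st ut.
apply: le_trans (IH _ _ _ _ _ _ _ _ (future_jump _ mt fC)) _;
  [lia|exact: sN|lia|].
rewrite prob_future_jump//; last by lia.
by rewrite mulrCA mulrA.
Qed.

Lemma law_zero : mu [set 0%N] = 0%E.
Proof.
rewrite -(Z_law (n := 1))// /distribution /pushforward.
rewrite [X in P X](_ : _ = set0) ?measure0//.
by rewrite -subset0 => w /= Z0; have := Z_pos (n := 1) isT w; rewrite Z0.
Qed.

Lemma sum_pmf n : \sum_(1 <= j < n) pmf j = fine (mu `I_n).
Proof.
have -> : `I_n = \big[setU/set0]_(i < n) [set (i : nat)].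
  rewrite -(bigcup_mkord n (fun i => [set i])); apply/seteqP.
  by split=> [i /= i_n|i /= [j /= jn ->]//]; exists i.
rewrite (@measure_semi_additive_ord_I _ _ _ mu (fun i => [set i]))//;
  last by apply/trivIsetP => i j _ _ /eqP ij; rewrite -subset0 => x [/= -> /ij].
rewrite -sum_fine; last by move=> i _; rewrite fin_num_measure.
case: n => [|n]; first by rewrite big_ord0 big_nil.
by rewrite big_ord_recl /= law_zero /= add0r big_add1 big_mkord.
Qed.

Lemma sum_pmf_le1 n : \sum_(1 <= j < n) pmf j <= 1.
Proof.
by rewrite sum_pmf -lee_fin fineK ?fin_num_measure// probability_le1.
Qed.

Lemma sum_pmf_near1 e : 0 < e ->
  exists n0, forall n, (n0 <= n)%N -> 1 - e <= \sum_(1 <= j < n) pmf j.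
Proof.
move=> e0.
have /fine_cvg : mu `I_n @[n --> \oo] --> 1%:E.
  have <- : mu (\bigcup_n `I_n) = 1%:E.
    rewrite [X in mu X](_ : _ = setT) ?probability_setT//.
    by apply/seteqP; split=> // i _; exists i.+1 => //=.
  apply: nondecreasing_cvg_mu => // m n mn; apply/subsetPset => i /=.
  by move=> /leq_trans; apply.
move=> /cvgrPdist_le /(_ _ e0)[n0 _ h]; exists n0 => n nn0; rewrite sum_pmf.
have /= := h _ nn0; rewrite ler_norml => /andP[_]; lra.
Qed.

Definition generation n k : set Omega := \big[setU/set0]_(t < n) descent k t.

Lemma measurable_generation n k : measurable (generation n k).
Proof. by apply: bigsetU_measurable => t _; exact: measurable_descent. Qed.

(** The second moment inequality with [a = 1 / (k + 1)], the value which is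
    optimal when [E N_k = 1] and [E N_k^2 = k + 1]. *)
Lemma prob_generation_ge n k :
  (2 * (\sum_(t < n) hit pmf k 0 t) - 1) / k.+1%:R <= Pr (generation n k).
Proof.
have k0 : 0 < k.+1%:R :> R by [].
have := @second_moment_bound _ _ _ P n (descent k) k.+1%:R^-1.
move/(_ (measurable_descent k)).
have -> : \sum_(t < n) Pr (descent k t) = \sum_(t < n) hit pmf k 0 t.
  apply: eq_bigr => t _; rewrite -[descent k t]setIT.
  by rewrite (prob_descent _ (future_setT t)) probability_setT /= mulr1.
have : \sum_(s < n) \sum_(t < n) Pr (descent k s `&` descent k t) <= k.+1%:R.
  apply: le_trans (sum_pair_bound pmf_ge0 sum_pmf_le1 n k).
  apply: ler_sum => s _; apply: ler_sum => t _.
  have := @prob_descent_pair n k k s t _ (ltn_ord s) (ltn_ord t).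
  by move/(_ _ (future_setT _)); rewrite setIT probability_setT mulr1.
set S := bigop _ _ _; set F := bigop _ _ _; set Q := fine _ => Sk.
rewrite -/(generation n k) invr_ge0 ltW// => /(_ isT).
set a := k.+1%:R^-1 => FQ.
have ak : a * k.+1%:R = 1 by rewrite mulVf// gt_eqF.
have a0 : 0 < a by rewrite invr_gt0.
have : a ^+ 2 * S <= a.
  rewrite -[leRHS]mulr1 -ak mulrA expr2 ler_wpM2l// mulr_ge0//; exact: ltW.
by rewrite mulrBl mul1r -/a; lra.
Qed.

Lemma expected_height_ge n K :
  ((\sum_(k < K) Pr (generation n.+1 k.+1))%:E <=
    'E_P[(fun w => (height0 (fun k => Z k w) n)%:R : R)])%E.
Proof.
rewrite expectation.unlock.
rewrite -(@integral_sum_indic _ _ _ P _ _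
  (fun k : 'I_K => generation n.+1 k.+1)); last first.
  by move=> k; exact: measurable_generation.
apply: ge0_le_integral_nonmeasurable => w; first by rewrite lee_fin sumr_ge0.
rewrite lee_fin; under eq_bigr do rewrite indicE.
rewrite -natr_sum ler_nat; apply: leq_trans (sum_generations_le_height _ _ K).
apply: leq_sum => k _; case: (boolP (w \in _)) => //.
rewrite inE /generation -(bigcup_mkord n.+1 (descent k.+1)) => -[t /= tn dt].
by rewrite lt0b; apply/existsP; exists (Ordinal tn).
Qed.

(** For [n] large the vertices up to [n] carry at least 3/4 of the mass of each
    of the generations 1, ..., [K], so generation [k + 1] is reached with
    probability at least [(1 / 2) / (k + 2)], which is at least
    [(1 / 4) / (k + 1)]. *)
Lemma expected_height_ge_harmonic K : exists n0, forall n, (n0 <= n)%N ->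
  ((series harmonic K / 4)%:E <=
    'E_P[(fun w => (height0 (fun k => Z k w) n)%:R : R)])%E.
Proof.
have [n0 hn0] : exists n0, forall n k, (n0 <= n)%N -> (k < K)%N ->
    3 / 4 <= \sum_(t < n) hit pmf k.+1 0 t.
  elim: K => [|K [a ha]]; first by exists 0%N.
  have q4 : 0 < 4^-1 :> R by rewrite invr_gt0.
  have [b hb] := sum_hit_near1 pmf_ge0 sum_pmf_le1 sum_pmf_near1 K.+1 q4.
  exists (maxn a b) => n k; rewrite geq_max => /andP[an bn].
  rewrite ltnS leq_eqVlt => /predU1P[->|kK]; last exact: ha.
  by have := hb _ bn; lra.
exists n0 => n nn0; apply: le_trans (expected_height_ge n K); rewrite lee_fin.
rewrite /series /= big_mkord mulr_suml; apply: ler_sum => k _.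
apply: le_trans (prob_generation_ge _ _).
have := hn0 n.+1 k (leqW nn0) (ltn_ord k); set F := bigop _ _ _ => F34.
apply: (@le_trans _ _ (2^-1 / k.+2%:R)); last first.
  by rewrite ler_wpM2r ?invr_ge0//; lra.
rewrite /harmonic -invfM -natrM -invfM -natrM lef_pV2 ?posrE// ler_nat; lia.
Qed.
End Process.

Theorem proposition8 (R : realType) (mu : probability nat R)
    (d : measure_display) (Omega : measurableType d)
    (P : probability Omega R) (Z : nat -> {RV P >-> nat})
    (Z_pos : forall n, (1 <= n)%N -> forall w, (1 <= Z n w)%N)
    (Z_law : forall n, (1 <= n)%N -> has_law (Z n) mu)
    (Z_indep : independent_RVs [set n | (1 <= n)%N] Z) :
  'E_P[(fun w => (height0 (fun k => Z k w) n)%:R : R)]%E @[n --> \oo]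
    --> +oo%E.
Proof.
apply/cvgeyPge => A.
have /cvgryPge /(_ (4 * A))[K _ hK] : series (@harmonic R) @ \oo --> +oo.
  apply: nondecreasing_dvgn_lt; last exact: dvg_harmonic.
  by apply: nondecreasing_series => n _ _; exact: harmonic_ge0.
have [n0 h] := expected_height_ge_harmonic Z_pos Z_law Z_indep K.
exists n0 => // n /= nn0; apply: le_trans (h _ nn0).
by rewrite lee_fin; have := hK _ (leqnn K); lra.
Qed.
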